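(* Let $(C,\bigtriangleup,\sigma)$ be a braided coalgebra, let $A$ be a vector space, and let $\langle\cdot,\cdot\rangle:A\times C\to\mathbb{K}$ be a non-degenerate bilinear form such that the adjoints $\tau=\mathrm{adj}(\sigma):A\otimes A\to A\otimes A$ and $\mathrm{adj}(\bigtriangleup):A\otimes A\to A$ exist and $(A,\mathrm{adj}(\bigtriangleup),\tau)$ is a braided algebra. Let $\Phi:T(C)\to\mathscr{T}^2_\beta(C)$ be the unique (unital) algebra map with $\Phi(c)=1\underline{\otimes}c+c\underline{\otimes}1+\sum_{(c)}c_{(1)}\underline{\otimes}c_{(2)}$ for $c\in C$. Then the adjoint $\mathrm{adj}(\Phi):T(A)\underline{\otimes}T(A)\to T(A)$ of $\Phi$ is the quantum quasi-shuffle product $\Join_\tau$ on $T(A)$ built on the braided algebra $(A,\mathrm{adj}(\bigtriangleup),\tau)$: $$\mathrm{adj}(\Phi)=\Join_\tau .$$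
   Context: Everything is over a field $\mathbb{K}$ of characteristic $0$. A braiding on a vector space $V$ is an invertible linear map $\sigma\in\mathrm{End}(V\otimes V)$ with $(\sigma\otimes \mathrm{id})(\mathrm{id}\otimes \sigma)(\sigma\otimes \mathrm{id})=(\mathrm{id}\otimes \sigma)(\sigma\otimes \mathrm{id})(\mathrm{id}\otimes \sigma)$ on $V^{\otimes 3}$. Write $\sigma_k=\mathrm{id}_V^{\otimes k-1}\otimes\sigma\otimes\mathrm{id}_V^{\otimes n-k-1}$ on $V^{\otimes n}$. A braided coalgebra $(C,\bigtriangleup,\sigma)$ is a coalgebra $C$ with coproduct $\bigtriangleup$ and counit $\varepsilon$, and a braiding $\sigma$ on $C$, such that $(\mathrm{id}_C\otimes\bigtriangleup)\sigma=\sigma_1\sigma_2(\bigtriangleup\otimes\mathrm{id}_C)$ and $(\bigtriangleup\otimes\mathrm{id}_C)\sigma=\sigma_2\sigma_1(\mathrm{id}_C\otimes\bigtriangleup)$. Sweedler notation: $\bigtriangleup(c)=\sum_{(c)}c_{(1)}\otimes c_{(2)}$. A braided algebra $(A,\mu,\tau)$ is an associative (not necessarily unital) algebra $(A,\mu)$ with a braiding $\tau$ on $A$ such that $(\mathrm{id}_A\otimes\mu)\tau_1\tau_2=\tau(\mu\otimes\mathrm{id}_A)$ and $(\mu\otimes\mathrm{id}_A)\tau_2\tau_1=\tau(\mathrm{id}_A\otimes\mu)$. $T(C)=\bigoplus_{n\ge0}C^{\otimes n}$ is the tensor algebra with concatenation product $m$; $\underline{\otimes}$ denotes the tensor product between copies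 of $T(C)$ (or $T(A)$), to distinguish it from $\otimes$ inside. For any braided vector space $(V,\sigma)$ and $w\in\mathfrak{S}_n$ with reduced expression $w=s_{k_1}\cdots s_{k_l}$, $s_k=(k\ k{+}1)$ (products are composition of maps, right factor first), $T^\sigma_w=\sigma_{k_1}\cdots\sigma_{k_l}$ on $V^{\otimes n}$ (independent of the reduced expression). For $i,j\ge1$, $\chi_{ij}\in\mathfrak{S}_{i+j}$ is given by $\chi_{ij}(r)=j+r$ for $1\le r\le i$ and $\chi_{ij}(i+r)=r$ for $1\le r\le j$. On $T(C)\underline{\otimes}T(C)$, $\beta$ is given on $C^{\otimes i}\underline{\otimes}C^{\otimes j}$ by $T^\sigma_{\chi_{ij}}$ (values in $C^{\otimes j}\underline{\otimes}C^{\otimes i}$), and by the identity of $C^{\otimes i}$ when one of the factors has degree $0$ (i.e. $1\underline{\otimes}x\leftrightarrow x\underline{\otimes}1$). $\mathscr{T}^2_\beta(C)$ is the associative algebra $T(C)\underline{\otimes}T(C)$ with product $(m\otimes m)(\mathrm{id}_{T(C)}\otimes\beta\otimes\mathrm{id}_{T(C)})$. On tensor powers of $A$ write $\alpha_{i,j}=T^\tau_{\chi_{ij}}$ for $i,j\ge 1$ and $\alpha_{0,i}=\alpha_{i,0}=\mathrm{id}$. Pairings: $\langle\cdot,\cdot\rangle$ is extended to $T(A)\times T(C)$ by $\langle a_1\otimes\cdots\otimes a_n,c_1\otimes\cdots\otimes c_n\rangle=\prod_{k=1}^n\langle a_k,c_k\rangle$, by multiplication of scalars in degree $0$, and by $\langle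 A^{\otimes i},C^{\otimes j}\rangle=0$ for $i\ne j$; and to $(T(A)\underline{\otimes}T(A))\times(T(C)\underline{\otimes}T(C))$ by $\langle u\underline{\otimes}v,x\underline{\otimes}y\rangle=\langle u,x\rangle\langle v,y\rangle$. These forms are non-degenerate. The adjoint $\mathrm{adj}(f)$ of a linear map $f$ is the linear map in the opposite direction on the dual sides determined by the pairings; e.g. $\langle\mathrm{adj}(\sigma)(u),x\rangle=\langle u,\sigma(x)\rangle$ for $u\in A^{\otimes2}$, $x\in C^{\otimes2}$; $\langle\mathrm{adj}(\bigtriangleup)(u),c\rangle=\langle u,\bigtriangleup(c)\rangle$ for $u\in A^{\otimes 2}$, $c\in C$; and $\langle\mathrm{adj}(\Phi)(z),x\rangle=\langle z,\Phi(x)\rangle$ for $z\in T(A)\underline{\otimes}T(A)$, $x\in T(C)$. Quantum quasi-shuffle product: for a braided algebra $(A,\mu,\tau)$, $\Join_\tau$ is the bilinear product on $T(A)$ with $\lambda\Join_\tau x=x\Join_\tau\lambda=\lambda x$ for $\lambda\in\mathbb{K}$, and, with $\Join_{\tau(i,j)}$ its restriction to $A^{\otimes i}\underline{\otimes}A^{\otimes j}$, recursively for $i,j\ge1$ (with $u=a_1\otimes\cdots\otimes a_i$, $v=b_1\otimes\cdots\otimes b_j$, empty tensors equal to $1$): $$u\Join_\tau v=a_1\otimes\big((a_2\otimes\cdots\otimes a_i)\Join_\tau v\big)+(\mathrm{id}_A\otimes\Join_{\tau(i,j-1)})(\alpha_{i,1}\otimes\mathrm{id}_A^{\otimes j-1})(u\otimes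 v)+(\mu\otimes\Join_{\tau(i-1,j-1)})(\mathrm{id}_A\otimes\alpha_{i-1,1}\otimes\mathrm{id}_A^{\otimes j-1})(u\otimes v).$$ *)

(* Defs.v *)
From HB Require Import structures.
From mathcomp Require Import all_boot perm all_algebra.
From mathcomp Require Import zify.
From mathcomp Require Import boolp.

Set Implicit Arguments.
Unset Strict Implicit.
Unset Printing Implicit Defensive.

Import GRing.Theory.
Local Open Scope ring_scope.
Local Open Scope quotient_scope.

Section LinearExtension.
Variables (K : fieldType) (X : Type).

Definition lext (W : lmodType K) (f : X -> W) (s : seq (K * X)) : W :=
  \sum_(p <- s) p.1 *: f p.2.

Lemma lext_nil (W : lmodType K) (f : X -> W) : lext f [::] = 0.
Proof. exact: big_nil. Qed.

Lemma lext_cons (W : lmodType K) (f : X -> W) p s :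
  lext f (p :: s) = p.1 *: f p.2 + lext f s.
Proof. exact: big_cons. Qed.

Lemma lext_cat (W : lmodType K) (f : X -> W) s t :
  lext f (s ++ t) = lext f s + lext f t.
Proof. by rewrite /lext big_cat. Qed.

Lemma lext_scale (W : lmodType K) (f : X -> W) a s :
  lext f [seq (a * p.1, p.2) | p <- s] = a *: lext f s.
Proof.
by rewrite /lext big_map scaler_sumr; apply: eq_bigr => p _; rewrite scalerA.
Qed.

Definition respects (rels : seq (K * X) -> Prop) (W : lmodType K) (f : X -> W) :=
  forall r, rels r -> lext f r = 0.

End LinearExtension.

(* [pres rels] is the K-vector space with generators X and relations rels: two *)
(* formal combinations are identified when every map X -> W sending the        *)
(* relations to 0 gives them the same value.  As the quotient of the free      *)
(* module on X by the span of rels is one such W, this is the equality of that *)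
(* quotient; the universal property is plift_gen, plift_unique below.          *)
Section Presented.
Variables (K : fieldType) (X : choiceType) (rels : seq (K * X) -> Prop).

Definition peq : rel (seq (K * X)) := fun s t =>
  `[< forall (W : lmodType K) (f : X -> W), respects rels f -> lext f s = lext f t >].

Lemma peq_refl : reflexive peq. Proof. by move=> s; apply/asboolP. Qed.
Lemma peq_sym : symmetric peq.
Proof. by move=> s t; apply/asboolP/asboolP => h W f /h. Qed.
Lemma peq_trans : transitive peq.
Proof.
move=> t s u /asboolP h1 /asboolP h2; apply/asboolP => W f hf.
by rewrite (h1 _ _ hf) (h2 _ _ hf).
Qed.

Canonical peq_equiv := EquivRel peq peq_refl peq_sym peq_trans.

Definition pres : Type := {eq_quot peq}.
HB.instance Definition _ := Choice.on pres.
HB.instance Definition _ := Quotient.on pres.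
HB.instance Definition _ := EqQuotient.on pres.

Lemma pres_eqP (s t : seq (K * X)) :
  (\pi_pres s = \pi_pres t) <->
  (forall (W : lmodType K) (f : X -> W), respects rels f -> lext f s = lext f t).
Proof. by split=> [/eqmodP/asboolP|h] //; apply/eqmodP/asboolP. Qed.

Lemma lext_repr (W : lmodType K) (f : X -> W) s : respects rels f ->
  lext f (repr (\pi_pres s)) = lext f s.
Proof. by move: s => s; apply: (pres_eqP _ _).1; rewrite reprK. Qed.

Definition pzero : pres := \pi_pres [::].
Definition padd (x y : pres) : pres := \pi_pres (repr x ++ repr y).
Definition pscale (a : K) (x : pres) : pres :=
  \pi_pres [seq (a * p.1, p.2) | p <- repr x].
Definition popp (x : pres) : pres := pscale (-1) x.

Lemma pres_ext (x y : pres) :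
  (forall (W : lmodType K) (f : X -> W), respects rels f ->
     lext f (repr x) = lext f (repr y)) -> x = y.
Proof. by move=> h; rewrite -[x]reprK -[y]reprK; apply/pres_eqP. Qed.

Lemma lext_pzero (W : lmodType K) (f : X -> W) : respects rels f ->
  lext f (repr pzero) = 0.
Proof. by move=> hf; rewrite lext_repr // /lext big_nil. Qed.

Lemma lext_padd (W : lmodType K) (f : X -> W) (x y : pres) : respects rels f ->
  lext f (repr (padd x y)) = lext f (repr x) + lext f (repr y).
Proof. by move=> hf; rewrite lext_repr // lext_cat. Qed.

Lemma lext_pscale (W : lmodType K) (f : X -> W) a (x : pres) : respects rels f ->
  lext f (repr (pscale a x)) = a *: lext f (repr x).
Proof. by move=> hf; rewrite lext_repr // lext_scale. Qed.

Lemma paddA : associative padd.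
Proof. by move=> x y z; apply: pres_ext => W f hf; rewrite !lext_padd // addrA. Qed.
Lemma paddC : commutative padd.
Proof. by move=> x y; apply: pres_ext => W f hf; rewrite !lext_padd // addrC. Qed.
Lemma padd0 : left_id pzero padd.
Proof.
by move=> x; apply: pres_ext => W f hf; rewrite lext_padd // lext_pzero // add0r.
Qed.
Lemma paddN : left_inverse pzero popp padd.
Proof.
move=> x; apply: pres_ext => W f hf.
by rewrite lext_padd // lext_pscale // lext_pzero // scaleN1r addNr.
Qed.

HB.instance Definition _ := GRing.isZmodule.Build pres paddA paddC padd0 paddN.

Lemma lext_repr0 (W : lmodType K) (f : X -> W) : respects rels f ->
  lext f (repr (0 : pres)) = 0.
Proof. exact: lext_pzero. Qed.

Lemma lext_reprD (W : lmodType K) (f : X -> W) (x y : pres) : respects rels f ->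
  lext f (repr (x + y)) = lext f (repr x) + lext f (repr y).
Proof. exact: lext_padd. Qed.

Lemma pscaleA a b (x : pres) : pscale a (pscale b x) = pscale (a * b) x.
Proof. by apply: pres_ext => W f hf; rewrite !lext_pscale // scalerA. Qed.
Lemma pscale1 : left_id 1 pscale.
Proof. by move=> x; apply: pres_ext => W f hf; rewrite !lext_pscale // scale1r. Qed.
Lemma pscaleDr : right_distributive pscale +%R.
Proof.
move=> a x y; apply: pres_ext => W f hf.
by rewrite lext_reprD // !lext_pscale // lext_reprD // scalerDr.
Qed.
Lemma pscaleDl (x : pres) : {morph pscale^~ x : a b / a + b}.
Proof.
move=> a b; apply: pres_ext => W f hf.
by rewrite lext_reprD // !lext_pscale // scalerDl.
Qed.

HB.instance Definition _ :=
  GRing.Zmodule_isLmodule.Build K pres pscaleA pscale1 pscaleDr pscaleDl.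

Lemma lext_reprZ (W : lmodType K) (f : X -> W) a (x : pres) : respects rels f ->
  lext f (repr (a *: x)) = a *: lext f (repr x).
Proof. exact: lext_pscale. Qed.

Definition gen (x : X) : pres := \pi_pres [:: (1, x)].

Lemma lext_gen (W : lmodType K) (f : X -> W) x : respects rels f ->
  lext f (repr (gen x)) = f x.
Proof. by move=> hf; rewrite lext_repr // /lext big_seq1 scale1r. Qed.

Lemma lext_sum (W : lmodType K) (f : X -> W) (s : seq (K * X)) :
  respects rels f -> lext f (repr (lext gen s)) = lext f s.
Proof.
move=> hf; elim: s => [|p s IH]; first by rewrite !lext_nil lext_repr0.
by rewrite !lext_cons lext_reprD // lext_reprZ // lext_gen // IH.
Qed.

Lemma presE (x : pres) : x = lext gen (repr x).
Proof. by apply: pres_ext => W f hf; rewrite lext_sum. Qed.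

Lemma gen_respects : respects rels gen.
Proof.
move=> r hr; apply: pres_ext => W f hf.
by rewrite lext_sum // lext_repr0 // hf.
Qed.

Section Lift.
Variables (W : lmodType K) (f : X -> W) (hf : respects rels f).

Definition plift of respects rels f : pres -> W := fun x => lext f (repr x).

Lemma plift_linear : linear (plift hf).
Proof. by move=> a x y; rewrite /plift lext_reprD // lext_reprZ. Qed.

HB.instance Definition _ :=
  GRing.isLinear.Build K pres W *:%R (plift hf) plift_linear.

Lemma plift_gen x : plift hf (gen x) = f x.
Proof. exact: lext_gen. Qed.

Lemma plift_unique (g : {linear pres -> W}) :
  (forall x, g (gen x) = f x) -> g =1 plift hf.
Proof.
move=> hg x; rewrite [in LHS](presE x) /lext linear_sum /=.
by apply: eq_bigr => p _; rewrite linearZ /= hg.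
Qed.
End Lift.
End Presented.

Section Lift2.
Variables (K : fieldType) (X Y : choiceType).
Variables (rX : seq (K * X) -> Prop) (rY : seq (K * Y) -> Prop).
Variables (W : lmodType K) (f : X -> Y -> W).
Hypotheses (fl : forall y, respects rX (f^~ y)) (fr : forall x, respects rY (f x)).

Definition plift2 of (forall y, respects rX (f^~ y)) & (forall x, respects rY (f x)) :
  pres rX -> pres rY -> W :=
  fun x y => lext (fun a => lext (f a) (repr y)) (repr x).

Lemma plift2_respects (y : pres rY) :
  respects rX (fun a => lext (f a) (repr y)).
Proof.
move=> r hr; rewrite /lext.
under eq_bigr do rewrite scaler_sumr.
rewrite exchange_big /= big1 // => q _.
under eq_bigr do rewrite scalerA mulrC -scalerA.
by rewrite -scaler_sumr [X in _ *: X](fl q.2 hr) scaler0.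
Qed.

Lemma plift2_bilinear : bilinear_for
  (GRing.Scale.Law.clone _ _ *:%R _) (GRing.Scale.Law.clone _ _ *:%R _)
  (plift2 fl fr).
Proof.
split=> [y|x] a u v /=; rewrite /plift2.
  by rewrite lext_reprD ?lext_reprZ //; exact: plift2_respects.
rewrite /lext scaler_sumr -big_split /=; apply: eq_bigr => p _.
rewrite -!/(lext _ _) lext_reprD // lext_reprZ //.
by rewrite scalerDr !scalerA mulrC.
Qed.

HB.instance Definition _ := bilinear_isBilinear.Build K (pres rX) (pres rY) W
  _ _ (plift2 fl fr) plift2_bilinear.

Lemma plift2_gen x y : plift2 fl fr (gen rX x) (gen rY y) = f x y.
Proof.
rewrite /plift2 lext_gen ?lext_gen //.
exact: plift2_respects.
Qed.
End Lift2.

Section Tensor.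
Variable K : fieldType.
Implicit Types U V W : lmodType K.

Inductive bilinear_rels U V : seq (K * (U * V)) -> Prop :=
| BilinearRelsL a u u' v :
    bilinear_rels [:: (1, (a *: u + u', v)); (- a, (u, v)); (-1, (u', v))]
| BilinearRelsR a u v v' :
    bilinear_rels [:: (1, (u, a *: v + v')); (- a, (u, v)); (-1, (u, v'))].

(* Tensor product over K of arbitrary, possibly infinite-dimensional, spaces. *)
Definition tens U V : lmodType K := pres (@bilinear_rels U V).

Definition ptens U V (u : U) (v : V) : tens U V := gen (@bilinear_rels U V) (u, v).

Local Notation "u \ox v" := (ptens u v) (at level 40, left associativity).

Lemma bilinear_respects U V W (f : U -> V -> W) :
  (forall v, linear (f^~ v)) -> (forall u, linear (f u)) ->
  respects (@bilinear_rels U V) (fun p => f p.1 p.2).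
Proof.
move=> fl fr _ [a u u' v|a u v v']; rewrite /lext !big_cons big_nil /=.
  by rewrite fl scale1r scaleN1r scaleNr addr0 -opprD subrr.
by rewrite fr scale1r scaleN1r scaleNr addr0 -opprD subrr.
Qed.

Lemma respects_bilinear U V W (f : U * V -> W) :
  respects (@bilinear_rels U V) f ->
  (forall v, linear (fun u => f (u, v))) * (forall u, linear (fun v => f (u, v))).
Proof.
move=> hf; split=> [v a u u'|u a v v'].
  move: (hf _ (BilinearRelsL a u u' v)); rewrite /lext !big_cons big_nil /=.
  by rewrite scale1r scaleN1r scaleNr addr0 -opprD => /subr0_eq.
move: (hf _ (BilinearRelsR a u v v')); rewrite /lext !big_cons big_nil /=.
by rewrite scale1r scaleN1r scaleNr addr0 -opprD => /subr0_eq.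
Qed.

Lemma ptens_bilinear U V : bilinear_for
  (GRing.Scale.Law.clone _ _ *:%R _) (GRing.Scale.Law.clone _ _ *:%R _)
  (@ptens U V).
Proof. 
have [hl hr] := respects_bilinear (@gen_respects _ _ (@bilinear_rels U V)).
by split=> [v|u]; [exact: hl | exact: hr].
Qed.

HB.instance Definition _ U V :=
  bilinear_isBilinear.Build K U V (tens U V) _ _ (@ptens U V) (@ptens_bilinear U V).

Definition bilinear2 U V W (f : U -> V -> W) :=
  (forall v, linear (f^~ v)) /\ (forall u, linear (f u)).

Lemma bilinear2P U V W (f : {bilinear U -> V -> W}) : bilinear2 f.
Proof. by split=> [v|u] a x y; rewrite ?linearPl ?linearPr. Qed.

Section TensorLift.
Variables (U V W : lmodType K) (f : U -> V -> W) (hf : bilinear2 f).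

Definition tlift : {linear tens U V -> W} :=
  plift (bilinear_respects hf.1 hf.2).

Lemma tliftE u v : tlift (u \ox v) = f u v.
Proof. exact: plift_gen. Qed.
End TensorLift.

Lemma ptens_ind U V (P : tens U V -> Prop) :
  P 0 -> (forall a u v x, P x -> P (a *: (u \ox v) + x)) -> forall x, P x.
Proof.
move=> P0 PD x; rewrite (presE x); elim: (repr x) => [|[a [u v]] s IH].
  by rewrite lext_nil.
by rewrite lext_cons; apply: PD.
Qed.

Lemma tens_ext U V W (f g : {linear tens U V -> W}) :
  (forall u v, f (u \ox v) = g (u \ox v)) -> f =1 g.
Proof.
move=> h; elim/ptens_ind => [|a u v x IH]; first by rewrite !linear0.
by rewrite !linearP /= h IH.
Qed.

Lemma tmap_subproof U V U' V' (f : {linear U -> U'}) (g : {linear V -> V'}) :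
  bilinear2 (fun u v => f u \ox g v).
Proof. by split=> [v|u] a x y /=; rewrite !linearP ?linearPl ?linearPr. Qed.

Definition tmap U V U' V' (f : {linear U -> U'}) (g : {linear V -> V'}) :
  {linear tens U V -> tens U' V'} := tlift (tmap_subproof f g).

Lemma tassoc_subproof1 U V W (w : W) :
  bilinear2 (fun (u : U) (v : V) => u \ox (v \ox w)).
Proof. by split=> [v|u] a x y /=; rewrite ?linearPl // ?linearPr. Qed.

Lemma tassoc_subproof2 U V W :
  bilinear2 (fun (z : tens U V) (w : W) => tlift (tassoc_subproof1 U V w) z).
Proof.
split=> [w|z] a x y /=; first by rewrite linearP.
elim/ptens_ind: z => [|b u v z IH]; first by rewrite !linear0 ?scaler0 addr0.
rewrite !linearP /= IH !tliftE !linearPr.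
by rewrite !scalerDr !scalerA mulrC addrACA.
Qed.

Definition tassoc U V W : {linear tens (tens U V) W -> tens U (tens V W)} :=
  tlift (@tassoc_subproof2 U V W).

Lemma tassocE U V W (u : U) (v : V) (w : W) :
  tassoc U V W ((u \ox v) \ox w) = u \ox (v \ox w).
Proof. by rewrite !tliftE. Qed.

Lemma tunassoc_subproof1 U V W (u : U) :
  bilinear2 (fun (v : V) (w : W) => (u \ox v) \ox w).
Proof. by split=> [v|w] a x y /=; rewrite !(linearPl, linearPr). Qed.

Lemma tunassoc_subproof2 U V W :
  bilinear2 (fun (u : U) (z : tens V W) => tlift (tunassoc_subproof1 V W u) z).
Proof.
split=> [z|u] a x y /=; last by rewrite linearP.
elim/ptens_ind: z => [|b v w z IH]; first by rewrite !linear0 ?scaler0 addr0.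
rewrite !linearP /= IH !tliftE !linearPl.
by rewrite !scalerDr !scalerA mulrC addrACA.
Qed.

Definition tunassoc U V W : {linear tens U (tens V W) -> tens (tens U V) W} :=
  tlift (@tunassoc_subproof2 U V W).

Lemma tunassocE U V W (u : U) (v : V) (w : W) :
  tunassoc U V W (u \ox (v \ox w)) = (u \ox v) \ox w.
Proof. by rewrite !tliftE. Qed.

End Tensor.

Notation "u \ox v" := (ptens u v) (at level 40, left associativity).

(* Strands are numbered from 0: [swap_nat k] is the transposition usually      *)
(* written s_(k+1), and it goes with the braiding of slots k and k+1.  In an   *)
(* expression the rightmost letter acts first.                                 *)
Section ReducedExpressions.

Definition swap_nat k (r : nat) : nat :=
  if r == k then k.+1 else if r == k.+1 then k else r.

Definition expression n (w : 'S_n) (ks : seq nat) : Prop :=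
  all (fun k => k.+1 < n)%N ks /\
  forall r : 'I_n, foldr swap_nat (val r) ks = val (w r).

Definition reduced n (w : 'S_n) (ks : seq nat) : Prop :=
  expression w ks /\ forall ks', expression w ks' -> (size ks <= size ks')%N.

Lemma swap_natK k : involutive (swap_nat k).
Proof.
move=> r; rewrite /swap_nat; case: (eqVneq r k) => [->|rk].
  by rewrite eqxx; case: eqP => // /esym/n_Sn.
case: (eqVneq r k.+1) => [->|rk1]; first by rewrite eqxx.
by rewrite (negPf rk) (negPf rk1).
Qed.

Lemma swap_nat_lt n k r : (k.+1 < n -> r < n -> swap_nat k r < n)%N.
Proof.
move=> kn rn; rewrite /swap_nat.
by case: eqP => // _; case: eqP => // _; exact: ltnW.
Qed.

Lemma expression_exists_nat n (w : nat -> nat) : injective w ->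
  (forall r, r < n -> w r < n)%N ->
  exists2 ks, all (fun k => k.+1 < n)%N ks &
    forall r, (r < n)%N -> foldr swap_nat r ks = w r.
Proof.
elim: n w => [|n IH] w winj wn; first by exists [::].
have [m] := ubnP (n - w n); elim: m w winj wn => // m IHm w winj wn lt_m.
have wnn := wn n (ltnSn n).
have [e|ne] := eqVneq (w n) n.
  have [|ks hks hw] := IH w winj.
    move=> r rn; have := wn r (ltnW rn); rewrite ltnS leq_eqVlt.
    by case/orP => // /eqP wr; move: rn; rewrite (winj r n) ?ltnn // e.
  exists ks; first by apply: sub_all hks => k /ltnW; rewrite ltnS.
  move=> r; rewrite ltnS leq_eqVlt => /orP[/eqP->|]; last exact: hw.
  rewrite e; elim: ks hks {hw} => //= k ks IHk /andP[kn /IHk ->].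
  by rewrite /swap_nat !gtn_eqF // ltnW.
have wn_lt : (w n < n)%N by rewrite ltn_neqAle ne -ltnS.
have [||| ks hks hw] := IHm (swap_nat (w n) \o w).
- by apply: inj_comp winj; exact: can_inj (swap_natK _).
- by move=> r rn; apply: swap_nat_lt; [rewrite ltnS | exact: wn].
- have -> : (swap_nat (w n) \o w) n = (w n).+1 by rewrite /= /swap_nat eqxx.
  by rewrite subnS; case: (n - w n)%N (subn_gt0 (w n) n) lt_m => [|d]; rewrite ?wn_lt.
exists (w n :: ks); first by rewrite /= ltnS wn_lt.
by move=> r rn; rewrite /= hw //= swap_natK.
Qed.

Lemma reduced_exists n (w : 'S_n) : exists ks, reduced w ks.
Proof.
pose w' r := if insub r is Some i then val (w i) else r.
have w'E (i : 'I_n) : w' i = w i by rewrite /w' valK.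
have w'N r : (n <= r)%N -> w' r = r by rewrite /w' => h; rewrite insubN // -leqNgt.
have w'lt r : (r < n)%N -> (w' r < n)%N by move=> h; rewrite (w'E (Ordinal h)).
have w'inj : injective w'.
  move=> r s; case: (ltnP r n) (ltnP s n) => hr [] hs.
  - rewrite (w'E (Ordinal hr)) (w'E (Ordinal hs)).
    by move/val_inj/perm_inj => [].
  - by rewrite [w' s]w'N // => e; move: (w'lt r hr); rewrite e ltnNge hs.
  - by rewrite [w' r]w'N // => e; move: (w'lt s hs); rewrite -e ltnNge hr.
  - by rewrite !w'N.
have [ks hks hw] := expression_exists_nat w'inj w'lt.
have ex : exists m, `[< exists2 ks, expression w ks & size ks = m >].
  exists (size ks); apply/asboolP; exists ks => //; split=> // r.
  by rewrite (hw _ (ltn_ord r)); exact: w'E.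
case: (ex_minnP ex) => m /asboolP[ks0 e0 sz0] mmin.
exists ks0; split=> // ks' e'; rewrite sz0; apply: mmin.
by apply/asboolP; exists ks'.
Qed.

(* Some reduced expression; for a braiding, [braid_word] of it does not depend *)
(* on the choice.                                                              *)
Definition reduced_word n (w : 'S_n) : seq nat := sval (cid (reduced_exists w)).

Lemma chi_subproof i j (r : 'I_(i + j)) :
  ((if r < i then j + r else r - i) < i + j)%N.
Proof.
case: ifP => h; first by rewrite addnC ltn_add2r.
by apply: leq_ltn_trans (leq_subr _ _) (ltn_ord r).
Qed.

Definition chi_fun i j (r : 'I_(i + j)) : 'I_(i + j) := Ordinal (chi_subproof r).

Lemma chi_inj i j : injective (@chi_fun i j).
Proof.
move=> r s /(congr1 val) /=; have := ltn_ord r; have := ltn_ord s.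
move=> hs hr h; apply: val_inj => /=; move: h.
by case: (ltnP r i) => ?; case: (ltnP s i) => ?; lia.
Qed.

Definition chi i j : 'S_(i + j) := perm (@chi_inj i j).

End ReducedExpressions.

Section TensorAlgebra.
Variable K : fieldType.
Implicit Types V W : lmodType K.

(* The tensor algebra: generated by the words v_1 ... v_n over V, i.e. the     *)
(* pure tensors of every length n, subject to linearity in every slot, hence   *)
(* the direct sum of the tensor powers of V; the empty word is the unit.       *)
(* Maps on a tensor power are represented by endomorphisms of the whole        *)
(* tensor algebra, whose values in the other degrees are irrelevant.           *)
Inductive multilinear_rels V : seq (K * seq V) -> Prop :=
| MultilinearRels s t a u v :
    multilinear_rels
      [:: (1, s ++ (a *: u + v) :: t); (- a, s ++ u :: t); (-1, s ++ v :: t)].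

Definition tensalg V : lmodType K := pres (@multilinear_rels V).

Definition word V (s : seq V) : tensalg V := gen (@multilinear_rels V) s.

Definition multilinear V W (f : seq V -> W) := forall s t a u v,
  f (s ++ (a *: u + v) :: t) = a *: f (s ++ u :: t) + f (s ++ v :: t).

Lemma multilinearP V W (f : seq V -> W) :
  multilinear f <-> respects (@multilinear_rels V) f.
Proof.
split=> [hf _ [s t a u v]|hf s t a u v].
  rewrite /lext !big_cons big_nil /= hf.
  by rewrite scale1r scaleN1r scaleNr addr0 -opprD subrr.
move: (hf _ (MultilinearRels s t a u v)); rewrite /lext !big_cons big_nil /=.
by rewrite scale1r scaleN1r scaleNr addr0 -opprD => /subr0_eq.
Qed.

Section WordLift.
Variables (V W : lmodType K) (f : seq V -> W) (hf : multilinear f).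

Definition wlift : {linear tensalg V -> W} := plift ((multilinearP f).1 hf).

Lemma wliftE s : wlift (word s) = f s.
Proof. exact: plift_gen. Qed.
End WordLift.

Lemma word_multilinear V : multilinear (@word V).
Proof. by apply/multilinearP/gen_respects. Qed.

Lemma word_ind V (P : tensalg V -> Prop) :
  P 0 -> (forall a s x, P x -> P (a *: word s + x)) -> forall x, P x.
Proof.
move=> P0 PD x; rewrite (presE x); elim: (repr x) => [|[a u] s IH].
  by rewrite lext_nil.
by rewrite lext_cons; apply: PD.
Qed.

Lemma tensalg_ext V W (f g : {linear tensalg V -> W}) :
  (forall s, f (word s) = g (word s)) -> f =1 g.
Proof.
move=> h; elim/word_ind => [|a s x IH]; first by rewrite !linear0.
by rewrite !linearP /= h IH.
Qed.

(* The map equal to F i j on the tensors of bidegree (i, j), these being       *)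
(* identified with the tensors of degree i + j.                                *)
Section Bigraded.
Variables (V W : lmodType K) (F : nat -> nat -> {linear tensalg V -> W}).

Lemma bigraded_subproofl t :
  respects (@multilinear_rels V) (fun s => F (size s) (size t) (word (s ++ t))).
Proof.
apply/multilinearP => s s' a u v.
by rewrite !size_cat /= -!catA !cat_cons word_multilinear linearP.
Qed.

Lemma bigraded_subproofr s :
  respects (@multilinear_rels V) (fun t => F (size s) (size t) (word (s ++ t))).
Proof.
apply/multilinearP => t t' a u v.
by rewrite !size_cat /= !catA word_multilinear linearP.
Qed.

Definition bigraded : {linear tens (tensalg V) (tensalg V) -> W} :=
  tlift (bilinear2P (plift2 bigraded_subproofl bigraded_subproofr)).

Lemma bigradedE s t :
  bigraded (word s \ox word t) = F (size s) (size t) (word (s ++ t)).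
Proof. by rewrite tliftE; exact: plift2_gen. Qed.
End Bigraded.

Definition tcat V : {linear tens (tensalg V) (tensalg V) -> tensalg V} :=
  bigraded (fun _ _ => idfun).

Lemma tcatE V (s t : seq V) : tcat V (word s \ox word t) = word (s ++ t).
Proof. exact: bigradedE. Qed.

(* Cuts a tensor of degree n >= k into its first k and its last n - k slots. *)
Lemma tsplit_subproof V k :
  multilinear (fun s : seq V => word (take k s) \ox word (drop k s)).
Proof.
move=> s t a u v; rewrite !take_cat !drop_cat; case: ifP => _.
  by rewrite word_multilinear linearPr.
case: (k - size s)%N => [|m] /=.
  by rewrite (word_multilinear [::]) linearPr.
by rewrite word_multilinear linearPl.
Qed.

Definition tsplit V k : {linear tensalg V -> tens (tensalg V) (tensalg V)} :=
  wlift (@tsplit_subproof V k).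

Lemma tsplitE V k (s : seq V) :
  tsplit V k (word s) = word (take k s) \ox word (drop k s).
Proof. exact: wliftE. Qed.

Lemma in1_linear V : linear (fun v : V => word [:: v]).
Proof. by move=> a u v; rewrite (word_multilinear [::] [::]). Qed.

Definition in1_fun V (v : V) := word [:: v].
HB.instance Definition _ V :=
  GRing.isLinear.Build K V (tensalg V) *:%R (@in1_fun V) (@in1_linear V).
Definition in1 V : {linear V -> tensalg V} := @in1_fun V.

Lemma in2_subproof V : bilinear2 (fun u v : V => word [:: u; v]).
Proof.
split=> [v|u] a x y.
  by rewrite (word_multilinear [::] [:: v]).
by rewrite (word_multilinear [:: u] [::]).
Qed.

Definition in2 V : {linear tens V V -> tensalg V} := tlift (@in2_subproof V).

(* Inverse of [in2] on the tensors of degree 2, and 0 in the other degrees. *)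
Lemma out2_subproof V :
  multilinear (fun s : seq V => if s is [:: u; v] then u \ox v else 0).
Proof.
move=> s t a u v; case: s t => [|x [|y [|z s]]] [|x' [|y' t]] //=;
  by rewrite ?scaler0 ?addr0 ?linearPl ?linearPr.
Qed.

Definition out2 V : {linear tensalg V -> tens V V} := wlift (@out2_subproof V).

(* id^(k) \ox g \ox id, with g acting on p consecutive slots, from slot k. *)
Definition on_slots V k p (g : {linear tensalg V -> tensalg V}) :
    {linear tensalg V -> tensalg V} :=
  tcat V \o tmap idfun (tcat V \o tmap g idfun \o tsplit V p) \o tsplit V k.

Definition braid_at V (sigma : {linear tens V V -> tens V V}) k :
  {linear tensalg V -> tensalg V} := on_slots k 2 (in2 V \o sigma \o out2 V).

Fixpoint braid_word V (sigma : {linear tens V V -> tens V V}) (ks : seq nat) :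
    {linear tensalg V -> tensalg V} :=
  if ks is k :: ks' then braid_at sigma k \o braid_word sigma ks' else idfun.

Definition braid_perm V (sigma : {linear tens V V -> tens V V}) n (w : 'S_n) :
  {linear tensalg V -> tensalg V} := braid_word sigma (reduced_word w).

Definition alpha V (sigma : {linear tens V V -> tens V V}) (i j : nat) :
    {linear tensalg V -> tensalg V} :=
  if (i == 0)%N || (j == 0)%N then (idfun : {linear tensalg V -> tensalg V})
  else braid_perm sigma (chi i j).

(* A value of degree i + j is cut after j slots, as the i strands have crossed *)
(* to the right of the j strands.                                              *)
Definition beta V (sigma : {linear tens V V -> tens V V}) :
    {linear tens (tensalg V) (tensalg V) -> tens (tensalg V) (tensalg V)} :=
  bigraded (fun i j => tsplit V j \o alpha sigma i j).

(* id \ox f \ox id *)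
Definition tmid V W (f : {linear tens V V -> tens W W}) :
    {linear tens (tens V V) (tens V V) -> tens (tens V W) (tens W V)} :=
  tunassoc V W (tens W V)
    \o tmap idfun (tassoc W W V \o tmap f idfun \o tunassoc V V V)
    \o tassoc V V (tens V V).

Definition beta_mul V (sigma : {linear tens V V -> tens V V}) :
    {linear tens (tens (tensalg V) (tensalg V)) (tens (tensalg V) (tensalg V)) ->
            tens (tensalg V) (tensalg V)} :=
  tmap (tcat V) (tcat V) \o tmid (beta sigma).

(* The triple tensor power is bracketed as V \ox (V \ox V). *)
Definition sigma1 V (sigma : {linear tens V V -> tens V V}) :
    {linear tens V (tens V V) -> tens V (tens V V)} :=
  tassoc V V V \o tmap sigma idfun \o tunassoc V V V.

Definition sigma2 V (sigma : {linear tens V V -> tens V V}) :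
    {linear tens V (tens V V) -> tens V (tens V V)} := tmap idfun sigma.

Definition braiding V (sigma : {linear tens V V -> tens V V}) : Prop :=
  bijective sigma /\
  forall x, sigma1 sigma (sigma2 sigma (sigma1 sigma x)) =
            sigma2 sigma (sigma1 sigma (sigma2 sigma x)).

Lemma tcontractl_subproof V (e : {linear V -> K^o}) :
  bilinear2 (fun u v : V => (e u : K) *: v).
Proof.
split=> [v|u] a x y /=; first by rewrite linearP scalerDl scalerA.
by rewrite scalerDr !scalerA mulrC.
Qed.

Definition tcontractl V (e : {linear V -> K^o}) : {linear tens V V -> V} :=
  tlift (tcontractl_subproof e).

Lemma tcontractr_subproof V (e : {linear V -> K^o}) :
  bilinear2 (fun u v : V => (e v : K) *: u).
Proof.
split=> [v|u] a x y /=; last by rewrite linearP scalerDl scalerA.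
by rewrite scalerDr !scalerA mulrC.
Qed.

Definition tcontractr V (e : {linear V -> K^o}) : {linear tens V V -> V} :=
  tlift (tcontractr_subproof e).

Definition coalgebra V (D : {linear V -> tens V V}) (e : {linear V -> K^o}) :
    Prop :=
  [/\ forall c, tassoc V V V (tmap D idfun (D c)) = tmap idfun D (D c),
      forall c, tcontractl e (D c) = c & forall c, tcontractr e (D c) = c].

Definition braided_coalgebra V (D : {linear V -> tens V V})
    (e : {linear V -> K^o}) (sigma : {linear tens V V -> tens V V}) : Prop :=
  [/\ coalgebra D e, braiding sigma,
      forall x, tmap idfun D (sigma x) =
                sigma1 sigma (sigma2 sigma (tassoc V V V (tmap D idfun x))) &
      forall x, tassoc V V V (tmap D idfun (sigma x)) =
                sigma2 sigma (sigma1 sigma (tmap idfun D x))].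

Definition braided_algebra V (mu : {linear tens V V -> V})
    (tau : {linear tens V V -> tens V V}) : Prop :=
  [/\ forall x, mu (tmap mu idfun x) = mu (tmap idfun mu (tassoc V V V x)),
      braiding tau,
      forall x, tmap idfun mu (sigma1 tau (sigma2 tau x)) =
                tau (tmap mu idfun (tunassoc V V V x)) &
      forall x, tmap mu idfun (tunassoc V V V (sigma2 tau (sigma1 tau x))) =
                tau (tmap idfun mu x)].

Section QuasiShuffle.
Variables (V : lmodType K) (mu : {linear tens V V -> V}).
Variable tau : {linear tens V V -> tens V V}.

Definition id_tens (g : {linear tensalg V -> tensalg V}) :
    {linear tensalg V -> tensalg V} := tcat V \o tmap idfun g \o tsplit V 1.

Definition mu_tens (g : {linear tensalg V -> tensalg V}) :
    {linear tensalg V -> tensalg V} :=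
  tcat V \o tmap (in1 V \o mu \o out2 V) g \o tsplit V 2.

(* [qshuffle_deg i j] takes the concatenation of u and v, of degrees i and j. *)
Fixpoint qshuffle_deg (i : nat) : nat -> {linear tensalg V -> tensalg V} :=
  if i is i'.+1 then
    fix qshuffle_degi (j : nat) : {linear tensalg V -> tensalg V} :=
      if j is j'.+1 then
        id_tens (qshuffle_deg i' j) \+
        ((id_tens (qshuffle_degi j') \o on_slots 0 i.+1 (alpha tau i 1)) \+
         (mu_tens (qshuffle_deg i' j') \o on_slots 1 i (alpha tau i' 1)))
      else idfun
  else fun _ => idfun.

Definition qshuffle : {linear tens (tensalg V) (tensalg V) -> tensalg V} :=
  bigraded qshuffle_deg.

End QuasiShuffle.

Section Pairings.
Variables (U V U' V' : lmodType K).

Lemma tens_pair_subproofl (p : {bilinear U -> U' -> K^o})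
    (q : {bilinear V -> V' -> K^o}) (y : U' * V') :
  respects (@bilinear_rels K U V) (fun x => p x.1 y.1 * q x.2 y.2 : K^o).
Proof.
apply: (@bilinear_respects K U V K^o (fun u v => p u y.1 * q v y.2)) => [v|u] a x z.
  by rewrite linearPl mulrDl -scalerAl.
by rewrite linearPl mulrDr -scalerAr.
Qed.

Lemma tens_pair_subproofr (p : {bilinear U -> U' -> K^o})
    (q : {bilinear V -> V' -> K^o}) (x : U * V) :
  respects (@bilinear_rels K U' V') (fun y => p x.1 y.1 * q x.2 y.2 : K^o).
Proof.
apply: (@bilinear_respects K U' V' K^o (fun u v => p x.1 u * q x.2 v)) => [v|u] a y z.
  by rewrite linearPr mulrDl -scalerAl.
by rewrite linearPr mulrDr -scalerAr.
Qed.

Definition tens_pair (p : {bilinear U -> U' -> K^o})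
    (q : {bilinear V -> V' -> K^o}) : {bilinear tens U V -> tens U' V' -> K^o} :=
  plift2 (tens_pair_subproofl p q) (tens_pair_subproofr p q).

Lemma tens_pairE p q u v u' v' :
  tens_pair p q (u \ox v) (u' \ox v') = p u u' * q v v'.
Proof. exact: plift2_gen. Qed.

Variable p : {bilinear U -> V -> K^o}.

Definition word_pair (s : seq U) (t : seq V) : K^o :=
  if size s == size t then \prod_(x <- zip s t) p x.1 x.2 else 0.

Lemma word_pair_subproofl t : respects (@multilinear_rels U) (word_pair^~ t).
Proof.
apply/multilinearP => s s' a u v; rewrite /word_pair !size_cat /=.
case: eqP => [e|]; last by rewrite scaler0 addr0.
rewrite -(cat_take_drop (size s) t).
have st : size (take (size s) t) = size s.
  by rewrite size_takel // -e leq_addr.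
have : size (drop (size s) t) = (size s').+1.
  by rewrite size_drop -e addKn.
case: (drop _ _) => // y t' _; rewrite !zip_cat //= !big_cat !big_cons /=.
by rewrite linearPl mulrDl mulrDr -scalerAl -scalerAr.
Qed.

Lemma word_pair_subproofr s : respects (@multilinear_rels V) (word_pair s).
Proof.
apply/multilinearP => t t' a u v; rewrite /word_pair !size_cat /=.
case: eqP => [e|]; last by rewrite scaler0 addr0.
rewrite -(cat_take_drop (size t) s).
have st : size (take (size t) s) = size t.
  by rewrite size_takel // e leq_addr.
have : size (drop (size t) s) = (size t').+1.
  by rewrite size_drop e addKn.
case: (drop _ _) => // y s' _; rewrite !zip_cat //= !big_cat !big_cons /=.
by rewrite linearPr mulrDl mulrDr -scalerAl -scalerAr.
Qed.

Definition tensalg_pair : {bilinear tensalg U -> tensalg V -> K^o} :=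
  plift2 word_pair_subproofl word_pair_subproofr.

Lemma tensalg_pairE s t : tensalg_pair (word s) (word t) = word_pair s t.
Proof. exact: plift2_gen. Qed.

End Pairings.

Definition nondegenerate_pairing U V (p : {bilinear U -> V -> K^o}) : Prop :=
  (forall u, (forall v, p u v = 0) -> u = 0) /\
  (forall v, (forall u, p u v = 0) -> v = 0).

(* g = adj(f); it is unique when p is non-degenerate. *)
Definition is_adjoint U V U' V' (p : {bilinear U -> V -> K^o})
    (p' : {bilinear U' -> V' -> K^o}) (f : {linear V -> V'})
    (g : {linear U' -> U}) : Prop :=
  forall u x, p (g u) x = p' u (f x).

Definition is_Phi V (D : {linear V -> tens V V})
    (sigma : {linear tens V V -> tens V V})
    (Phi : {linear tensalg V -> tens (tensalg V) (tensalg V)}) : Prop :=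
  [/\ Phi (word [::]) = word [::] \ox word [::],
      forall x y, Phi (tcat V (x \ox y)) = beta_mul sigma (Phi x \ox Phi y) &
      forall c, Phi (in1 V c) =
        word [::] \ox in1 V c + in1 V c \ox word [::]
        + tmap (in1 V) (in1 V) (D c)].

End TensorAlgebra.

(* Main.v *)
Require Import Defs.
From mathcomp Require Import all_boot all_algebra.
From HB Require Import structures.
From mathcomp Require Import perm zify boolp.

(** The adjoint of [Phi] is the quantum quasi-shuffle product because the
    multiplicativity of [Phi] is, seen through the pairing, the recursion that
    defines the quasi-shuffle product.

    Write [Phi_ij] for the component of [Phi] of bidegree [(i, j)], followed by
    the concatenation into degree [i + j].  Multiplying by the three terms of
    [Phi c] in the braided tensor square gives
      [Phi_ij (c t) = alpha_1i (c Phi_i(j-1) t) + c Phi_(i-1)j t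
                      + (id (x) alpha_1(i-1)) (Delta c Phi_(i-1)(j-1) t)]
    ([cat_bideg_Phi_cons]).  Prepending [c] is adjoint to removing a first
    letter, [Delta] is adjoint to [mu], and [alpha sigma 1 i] is adjoint to
    [alpha tau i 1]; term by term this is the adjoint of the recursion for the
    product of tensors of degrees [i] and [j], so that the two are adjoint by
    induction on [t] ([qshuffle_deg_adj]).

    The adjointness of the braidings rests on the reduced expressions of
    [chi 1 i] and [chi i 1].  Passing to adjoints reverses a word in the
    generators.  In both permutations a single strand moves by [i] positions,
    and each letter moves it by at most one; hence a reduced expression has
    exactly the [i] letters that this strand needs, in the order in which it
    needs them, and those of [chi 1 i] and [chi i 1] are the reverses of each
    other.

    The converse implication is the uniqueness of adjoints, that is, the
    non-degeneracy of the pairing on the tensor algebras.  Finitely many vectors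
    of [A] can be expanded through the pairing with finitely many pairs in
    [A * C] ([dual_expansion]); expanding every letter of a tensor recovers this
    tensor from its pairings with words over [C]. *)

Set Implicit Arguments.
Unset Strict Implicit.
Unset Printing Implicit Defensive.

Import GRing.Theory.
Local Open Scope ring_scope.

Local Notation "x ** y" := (tcat _ (x \ox y)) (at level 40).

(** * Linear maps on the tensor algebra *)

(** Evaluation of composites is a rewriting rule because simplification would
    also unfold the maps that are composed. *)
Lemma lcompE (K : fieldType) (U V W : lmodType K) (g : {linear V -> W})
    (f : {linear U -> V}) x : ((g \o f)%FUN : {linear U -> W}) x = g (f x).
Proof. by []. Qed.

Lemma tmapE (K : fieldType) (U V U' V' : lmodType K) (f : {linear U -> U'})
    (g : {linear V -> V'}) u v : tmap f g (u \ox v) = f u \ox g v.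
Proof. exact: tliftE. Qed.

Lemma laddE (K : fieldType) (U W : lmodType K) (f g : {linear U -> W}) x :
  ((f \+ g)%FUN : {linear U -> W}) x = f x + g x.
Proof. by []. Qed.

Lemma regular_scaleE (K : fieldType) (a : K) (x : K^o) : a *: x = a * x :> K.
Proof. by []. Qed.

(** Composites through [u \ox _] are thereby linear, and so determined by words. *)
HB.instance Definition _ (K : fieldType) (U V : lmodType K) (u : U) :=
  GRing.isLinear.Build K V (tens U V) *:%R (ptens u)
    ((bilinear2P (@ptens K U V)).2 u).

Section Words.
Variables (K : fieldType) (V : lmodType K).

(** Homogeneous tensors, as an inductive predicate so that properties of
    homogeneous tensors are proved by induction from words of one length. *)
Inductive homog (n : nat) : tensalg V -> Prop :=
| Homog0 : homog n 0
| HomogD a s x : size s = n -> homog n x -> homog n (a *: word s + x).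

Lemma homog_word s : homog (size s) (word s).
Proof. by rewrite -[word s]addr0 -[word s]scale1r; do !constructor. Qed.

Lemma homogZD n a x y : homog n x -> homog n y -> homog n (a *: x + y).
Proof.
move=> hx hy; elim: hx => [|b s z hs _ IH]; first by rewrite scaler0 add0r.
by rewrite scalerDr scalerA -addrA; constructor.
Qed.

Lemma homog_lin n m (f : {linear tensalg V -> tensalg V}) x :
  (forall s, size s = n -> homog m (f (word s))) -> homog n x -> homog m (f x).
Proof.
move=> hf; elim=> [|a s y hs _ IH]; first by rewrite linear0; constructor.
by rewrite linearP; apply: homogZD => //; apply: hf.
Qed.

Lemma homog_cat n m x y : homog n x -> homog m y -> homog (n + m) (x ** y).
Proof.
move=> hx hy; elim: hx => [|a s z hs _ IH].
  by rewrite linear0l linear0; constructor.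
rewrite linearPl linearP; apply: homogZD IH.
elim: hy => [|b t w ht _ IH]; first by rewrite linear0r linear0; constructor.
rewrite linearPr linearP; apply: homogZD IH.
by rewrite tcatE -hs -ht -size_cat; apply: homog_word.
Qed.

Lemma homog_in2 z : homog 2 (in2 V z).
Proof.
elim/ptens_ind: z => [|a u v z IH]; first by rewrite linear0; constructor.
by rewrite linearP; apply: homogZD IH; rewrite tliftE; apply: homog_word [:: u; v].
Qed.

Definition graded (f : {linear tensalg V -> tensalg V}) :=
  forall n x, homog n x -> homog n (f x).

Lemma on_slotsE k p g (s : seq V) : on_slots k p g (word s) =
  word (take k s) ** (g (word (take p (drop k s))) ** word (drop p (drop k s))).
Proof. by rewrite /on_slots !lcompE tsplitE tmapE !lcompE tsplitE tmapE. Qed.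

Lemma on_slots_graded k p g : graded g -> graded (on_slots k p g).
Proof.
move=> hg n x; apply: homog_lin => s <-; rewrite on_slotsE.
have -> : size s = (size (take k s)
    + (size (take p (drop k s)) + size (drop p (drop k s))))%N.
  by rewrite -!size_cat !cat_take_drop.
apply: homog_cat (homog_word _) _; apply: homog_cat _ (homog_word _).
by apply: hg; apply: homog_word.
Qed.

Lemma braid_map_graded (sg : {linear tens V V -> tens V V}) :
  graded (in2 V \o sg \o out2 V).
Proof.
move=> n x; apply: homog_lin => w hs.
rewrite !lcompE wliftE; case: w hs => [|u [|v [|w z]]] hs /=;
  by [rewrite !linear0; constructor | rewrite -hs; apply: homog_in2].
Qed.

Lemma braid_word_graded (sg : {linear tens V V -> tens V V}) ks :
  graded (braid_word sg ks).
Proof.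
elim: ks => [|k ks IH] n x hx //; rewrite [braid_word _ _]/= lcompE.
exact: on_slots_graded (braid_map_graded sg) _ _ (IH _ _ hx).
Qed.

Lemma braid_word_rcons (sg : {linear tens V V -> tens V V}) ks k x :
  braid_word sg (rcons ks k) x = braid_word sg ks (braid_at sg k x).
Proof. by elim: ks => // l ks IH; rewrite [braid_word _ _]/= !lcompE IH. Qed.

Lemma on_slots_id k q x : on_slots k q (idfun : {linear tensalg V -> tensalg V}) x = x.
Proof.
elim/word_ind: x => [|a t x IH]; first by rewrite linear0.
by rewrite linearP IH on_slotsE !tcatE !cat_take_drop.
Qed.

Lemma tens_words_ext (W : lmodType K) (f g : {linear tens (tensalg V) (tensalg V) -> W}) :
  (forall x y, f (word x \ox word y) = g (word x \ox word y)) -> f =1 g.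
Proof.
move=> h; apply: tens_ext => u v.
elim/word_ind: u => [|a x u IH]; first by rewrite linear0l !linear0.
rewrite linearPl !linearP /= {}IH; congr (_ *: _ + _).
elim/word_ind: v => [|b y v IH]; first by rewrite linear0r !linear0.
by rewrite linearPr !linearP /= {}IH h.
Qed.

End Words.

(** * Adjoint maps on the tensor algebras *)

Section Adjoints.
Variables (K : fieldType) (A C : lmodType K) (p : {bilinear A -> C -> K^o}).
Local Notation P := (tensalg_pair p).
Local Notation adj g f := (is_adjoint P P f g).

Lemma pair_homog0 n m x y : homog n x -> homog m y -> n != m -> P x y = 0.
Proof.
move=> hx hy nm; elim: hx => [|a s z hs _ IH]; first by rewrite linear0l.
rewrite linearPl IH addr0; elim: hy => [|b t w ht _ IH2].
  by rewrite linear0r scaler0.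
rewrite linearPr tensalg_pairE /word_pair hs ht (negPf nm) scaler0 add0r.
exact: IH2.
Qed.

Lemma word_pair_cat s1 s2 t1 t2 : size s1 = size t1 ->
  word_pair p (s1 ++ s2) (t1 ++ t2) = (word_pair p s1 t1 : K) * word_pair p s2 t2.
Proof.
move=> e; rewrite /word_pair !size_cat e eqn_add2l eqxx.
case: eqP => [e2|]; last by rewrite mulr0.
by rewrite zip_cat // big_cat.
Qed.

(** Homogeneity of the left factors makes both products cut at the same place. *)
Lemma pair_cat n x x' y y' : homog n x -> homog n x' ->
  P (x ** y) (x' ** y') = (P x x' : K) * P y y'.
Proof.
move=> hx hx'; elim: hx => [|a s z hs _ IH].
  by rewrite !(linear0l, linear0) mul0r.
rewrite !(linearPl, linearP) {}IH mulrDl !regular_scaleE -mulrA; congr (_ * _ + _).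
elim: hx' => [|b t w ht _ IH]; first by rewrite !(linear0l, linear0, linear0r) mul0r.
rewrite !(linearPr, linearPl, linearP) {}IH mulrDl !regular_scaleE -mulrA; congr (_ * _ + _).
elim/word_ind: y => [|c u z' IH]; first by rewrite !(linear0r, linear0, linear0l) mulr0.
rewrite !(linearPr, linearP, linearPl) {}IH mulrDr !regular_scaleE mulrCA; congr (_ * _ + _).
elim/word_ind: y' => [|d v w' IH]; first by rewrite !(linear0r, linear0) mulr0.
rewrite !(linearPr, linearP) {}IH mulrDr !regular_scaleE mulrCA; congr (_ * _ + _).
by rewrite !tcatE !tensalg_pairE word_pair_cat // hs ht.
Qed.

Lemma adj_words (f : {linear tensalg A -> tensalg A}) (g : {linear tensalg C -> tensalg C}) :
  (forall s t, P (f (word s)) (word t) = P (word s) (g (word t))) -> adj f g.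
Proof.
move=> h x y; elim/word_ind: x => [|a s x IH].
  by rewrite [f 0]linear0 !linear0l.
rewrite [f (_ + _)]linearP !linearPl {}IH; congr (_ *: _ + _).
elim/word_ind: y => [|b t y IH]; first by rewrite [g 0]linear0 !linear0r.
by rewrite [g (_ + _)]linearP !linearPr {}IH h.
Qed.

(** Between words of different lengths both pairings vanish, as the maps are
    graded; between words of the same length the pairing splits into the factors
    before, inside and after the slots acted on. *)
Lemma adj_on_slots k q f g : graded f -> graded g -> adj f g ->
  adj (on_slots k q f) (on_slots k q g).
Proof.
move=> hf hg hfg; apply: adj_words => s t.
have [e|ne] := eqVneq (size s) (size t); last first.
  rewrite (pair_homog0 (n := size s) (m := size t)) ?(pair_homog0 (n := size s) (m := size t)) //;
  by try (apply: on_slots_graded => //); exact: homog_word.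
rewrite !on_slotsE.
have eW (V : lmodType K) (w : seq V) : word w =
    word (take k w) ** (word (take q (drop k w)) ** word (drop q (drop k w))).
  by rewrite !tcatE !cat_take_drop.
rewrite [in LHS](eW _ t) [in RHS](eW _ s).
have e1 : size (take k t) = size (take k s) by rewrite !size_take_min e.
have e2 : size (take q (drop k t)) = size (take q (drop k s)).
  by rewrite !size_take_min !size_drop e.
have ht1 := homog_word (take k t); have ht2 := homog_word (take q (drop k t)).
have hs1 := homog_word (take k s); have hs2 := homog_word (take q (drop k s)).
rewrite e1 in ht1; rewrite e2 in ht2.
rewrite [LHS](pair_cat _ _ hs1 ht1) [in LHS](pair_cat _ _ (hf _ _ hs2) ht2).
rewrite [RHS](pair_cat _ _ hs1 ht1) [in RHS](pair_cat _ _ hs2 (hg _ _ ht2)).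
by rewrite hfg.
Qed.

Lemma pair_in2l z y : P (in2 A z) y = tens_pair p p z (out2 C y).
Proof.
elim/word_ind: y => [|b t y IH]; first by rewrite [out2 C 0]linear0 !linear0r.
rewrite [out2 C (_ + _)]linearP !linearPr {}IH; congr (_ *: _ + _).
elim/ptens_ind: z => [|a u v z IH]; first by rewrite [in2 A 0]linear0 !linear0l.
rewrite [in2 A (_ + _)]linearP !linearPl {}IH; congr (_ *: _ + _).
rewrite tliftE tensalg_pairE wliftE /word_pair.
case: t => [|c [|d [|e t]]]; rewrite ?linear0r //.
by rewrite tens_pairE /= !big_cons big_nil mulr1.
Qed.

Lemma pair_in2r x z : P x (in2 C z) = tens_pair p p (out2 A x) z.
Proof.
elim/word_ind: x => [|b t x IH]; first by rewrite [out2 A 0]linear0 !linear0l.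
rewrite [out2 A (_ + _)]linearP !linearPl {}IH; congr (_ *: _ + _).
elim/ptens_ind: z => [|a u v z IH]; first by rewrite [in2 C 0]linear0 !linear0r.
rewrite [in2 C (_ + _)]linearP !linearPr {}IH; congr (_ *: _ + _).
rewrite tliftE tensalg_pairE wliftE /word_pair.
case: t => [|c [|d [|e t]]]; rewrite ?linear0l //.
by rewrite tens_pairE /= !big_cons big_nil mulr1.
Qed.

Lemma pair_in1 a c : P (in1 A a) (in1 C c) = p a c.
Proof. by rewrite tensalg_pairE /word_pair /= big_cons big_nil mulr1. Qed.

Variables (sigma : {linear tens C C -> tens C C}) (tau : {linear tens A A -> tens A A}).
Hypothesis htau : is_adjoint (tens_pair p p) (tens_pair p p) sigma tau.

Lemma adj_braid_at k : adj (braid_at tau k) (braid_at sigma k).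
Proof.
apply: adj_on_slots; try exact: braid_map_graded.
by move=> x y; rewrite !lcompE pair_in2l htau pair_in2r.
Qed.

(** Adjunction reverses composition, hence the order of the letters. *)
Lemma adj_braid_word ks : adj (braid_word tau ks) (braid_word sigma (rev ks)).
Proof.
elim: ks => [|k ks IH] x y //.
by rewrite rev_cons braid_word_rcons [braid_word tau _]/= lcompE adj_braid_at IH.
Qed.

End Adjoints.

(** * Reduced expressions of the permutations moving one strand *)

Lemma foldr_swap_iota m i r :
  foldr swap_nat r (iota m i) =
    if r == (m + i)%N then m else if (m <= r < m + i)%N then r.+1 else r.
Proof.
elim: i m => [|i IH] m /=; first by rewrite addn0; repeat case: ifP; lia.
rewrite IH /swap_nat; repeat case: ifP; lia.
Qed.

Lemma foldr_swap_rev_iota m i r :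
  foldr swap_nat r (rev (iota m i)) =
    if r == m then (m + i)%N else if (m < r <= m + i)%N then r.-1 else r.
Proof.
elim: i m r => [|i IH] m r /=; first by rewrite addn0; repeat case: ifP; lia.
rewrite rev_cons foldr_rcons IH; have: swap_nat m r = if r == m then m.+1 else
    if r == m.+1 then m else r by [].
by move: (swap_nat m r) => q; repeat case: ifP; lia.
Qed.

Lemma reduced_wordP n (w : 'S_n) : reduced w (reduced_word w).
Proof. exact: svalP. Qed.

(** A strand moves by at most one position per letter, in either direction. *)
Lemma foldr_swap_geq (ks : seq nat) r : (r <= foldr swap_nat r ks + size ks)%N.
Proof.
elim: ks => [|k ks] /=; first by rewrite addn0.
by move: (foldr _ _ _) => q; rewrite /swap_nat; repeat case: ifP; lia.
Qed.

Lemma foldr_swap_leq (ks : seq nat) r : (foldr swap_nat r ks <= r + size ks)%N.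
Proof.
elim: ks => [|k ks] /=; first by rewrite addn0.
by move: (foldr _ _ _) => q; rewrite /swap_nat; repeat case: ifP; lia.
Qed.

(** An expression of at most [i] letters that moves a strand down by [i] has to
    lower it at every letter, which determines each letter in turn. *)
Lemma descending_word (ks : seq nat) m i :
  foldr swap_nat (m + i)%N ks = m -> (size ks <= i)%N -> ks = iota m i.
Proof.
elim: ks m i => [|k ks IH] m [|i] //=; first by lia.
move=> e hs; have := foldr_swap_geq ks (m + i.+1); move: e.
have := IH m.+1 i; rewrite addSnnS; move: (foldr _ _ _) => q hq.
rewrite /swap_nat; case: (q =P k) => [-> e hk|_]; first by exfalso; lia.
case: (q =P k.+1) => [eq1 e hk|? e hk]; last by exfalso; lia.
by rewrite hq ?e //; lia.
Qed.

(** The mirror image of [descending_word]. *)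
Lemma ascending_word (ks : seq nat) m i :
  foldr swap_nat m ks = (m + i)%N -> (size ks <= i)%N -> ks = rev (iota m i).
Proof.
elim: ks i => [|k ks IH] [|i] //=; first by lia.
have -> : rev (m :: iota m.+1 i) = (m + i)%N :: rev (iota m i).
  by rewrite -[m :: _]/(iota m i.+1) -addn1 iotaD rev_cat.
move=> e hs; have := foldr_swap_leq ks m; move: e.
have := IH i; move: (foldr _ _ _) => q hq.
rewrite /swap_nat; case: (q =P k) => [eqk e hk|_].
  by rewrite -hq; [congr (_ :: _) | |]; lia.
by case: (q =P k.+1) => ? e hk; exfalso; lia.
Qed.

Lemma expression_chi_i1 i : expression (chi i 1) (iota 0 i).
Proof.
split; first by apply/allP => k; rewrite mem_iota; lia.
move=> r; rewrite foldr_swap_iota permE /=; have := ltn_ord r.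
by repeat case: ifP; lia.
Qed.

Lemma expression_chi_1i i : expression (chi 1 i) (rev (iota 0 i)).
Proof.
split; first by apply/allP => k; rewrite mem_rev mem_iota; lia.
move=> r; rewrite foldr_swap_rev_iota permE /=; have := ltn_ord r.
by repeat case: ifP; lia.
Qed.

(** Minimality bounds the length by that of the explicit expression, and the
    strand numbered [i] goes down to [0]; so the choice made in [reduced_word]
    is forced. *)
Lemma reduced_word_chi_i1 i : reduced_word (chi i 1) = iota 0 i.
Proof.
have [[_ h] hmin] := reduced_wordP (chi i 1).
apply: descending_word; last first.
  by have := hmin _ (expression_chi_i1 i); rewrite size_iota.
have hi : (i < i + 1)%N by rewrite addn1.
by have := h (Ordinal hi); rewrite permE /= ltnn subnn.
Qed.

Lemma reduced_word_chi_1i i : reduced_word (chi 1 i) = rev (iota 0 i).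
Proof.
have [[_ h] hmin] := reduced_wordP (chi 1 i).
apply: ascending_word; last first.
  by have := hmin _ (expression_chi_1i i); rewrite size_rev size_iota.
by have := h (Ordinal (ltn0Sn i)); rewrite permE /= addn0.
Qed.

Lemma alpha_i1 (K : fieldType) (V : lmodType K) (s : {linear tens V V -> tens V V}) i :
  alpha s i 1 = braid_word s (iota 0 i).
Proof. by case: i => // i; rewrite /alpha /braid_perm reduced_word_chi_i1. Qed.

Lemma alpha_1i (K : fieldType) (V : lmodType K) (s : {linear tens V V -> tens V V}) i :
  alpha s 1 i = braid_word s (rev (iota 0 i)).
Proof. by case: i => // i; rewrite /alpha /braid_perm reduced_word_chi_1i. Qed.

Lemma alpha_i1_graded (K : fieldType) (V : lmodType K) (s : {linear tens V V -> tens V V}) i :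
  graded (alpha s i 1).
Proof. by rewrite alpha_i1; apply: braid_word_graded. Qed.

Lemma alpha_1i_graded (K : fieldType) (V : lmodType K) (s : {linear tens V V -> tens V V}) i :
  graded (alpha s 1 i).
Proof. by rewrite alpha_1i; apply: braid_word_graded. Qed.

(** * Bidegree components of the product in the braided tensor square *)

Section Bidegree.
Variables (K : fieldType) (V : lmodType K) (s : {linear tens V V -> tens V V}).

(** Projection to bidegree [(i, j)] followed by concatenation; it is adjoint to
    cutting a tensor of degree [i + j] after [i] slots ([pair_cat_bideg]), and
    turns maps into the tensor square into endomorphisms. *)
Definition cat_bideg (i j : nat) : {linear tens (tensalg V) (tensalg V) -> tensalg V} :=
  bigraded (fun i' j' => if (i' == i) && (j' == j)
    then (idfun : {linear tensalg V -> tensalg V})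
    else (\0 : {linear tensalg V -> tensalg V})).

Lemma cat_bidegE i j x y : cat_bideg i j (word x \ox word y) =
  if (size x == i) && (size y == j) then word (x ++ y) else 0.
Proof. by rewrite bigradedE; case: ifP. Qed.

(** The braiding cuts its value after [size x] slots and the product glues the
    pieces back together, so the concatenation only sees the crossing of [v]
    with [x]. *)
Lemma cat_bideg_beta_mul i j u v x y :
  graded (alpha s (size v) (size x)) ->
  cat_bideg i j (beta_mul s ((word u \ox word v) \ox (word x \ox word y))) =
  if (size u + size x == i)%N && (size v + size y == j)%N
  then on_slots (size u) (size v + size x) (alpha s (size v) (size x))
         (word (u ++ v ++ x ++ y))
  else 0.
Proof.
move=> hal; rewrite on_slotsE /beta_mul /tmid !lcompE tassocE tmapE !lcompE tunassocE tmapE.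
rewrite bigradedE lcompE take_size_cat // drop_size_cat //.
rewrite [v ++ x ++ y]catA take_size_cat ?size_cat // drop_size_cat ?size_cat //.
have := hal _ _ (homog_word (v ++ x)); move: (alpha _ _ _ _) => Y.
rewrite size_cat; elim=> [|a t z ht _ IH].
  rewrite [tsplit _ _ 0]linear0 linear0l [tassoc _ _ _ 0]linear0 linear0r.
  rewrite [tunassoc _ _ _ 0]linear0 [tmap _ _ 0]linear0 [cat_bideg _ _ 0]linear0.
  by rewrite linear0l [tcat _ 0]linear0 linear0r [tcat _ 0]linear0 if_same.
rewrite [tsplit _ _ _]linearP linearPl [tassoc _ _ _ _]linearP linearPr.
rewrite [tunassoc _ _ _ _]linearP [tmap _ _ _]linearP [cat_bideg _ _ _]linearP.
rewrite {}IH linearPl [tcat _ (_ + _)]linearP linearPr [tcat _ (_ + _)]linearP.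
have -> : cat_bideg i j (tmap (tcat V) (tcat V) (tunassoc _ _ _ (word u \ox
    tassoc _ _ _ (tsplit V (size x) (word t) \ox word y)))) =
  if (size u + size x == i)%N && (size v + size y == j)%N then
    word u ** (word t ** word y) else 0.
  rewrite tsplitE tassocE tunassocE tmapE !tcatE cat_bidegE !size_cat size_drop.
  rewrite size_takel ?ht ?leq_addl // addnK.
  by rewrite -catA [take _ _ ++ _]catA cat_take_drop.
by case: ifP => // _; rewrite scaler0 addr0.
Qed.

Lemma beta_mulDl a b z : beta_mul s ((a + b) \ox z) =
  beta_mul s (a \ox z) + beta_mul s (b \ox z).
Proof. by rewrite linearDl [LHS]linearD. Qed.

(** Left multiplication by the three kinds of terms of [Phi c]; the letter on
    the right-hand side of a tensor has to cross the left factor of [z]. *)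
Lemma cat_bideg_left i j c z :
  cat_bideg i j (beta_mul s ((in1 V c \ox word [::]) \ox z)) =
  if i is i'.+1 then in1 V c ** cat_bideg i' j z else 0.
Proof.
pose w := in1 V c \ox (word [::] : tensalg V).
case: i => [|i].
  apply: (tens_words_ext (f := cat_bideg 0 j \o (beta_mul s \o ptens w))
    (g := \0) _ z) => x y.
  by rewrite !lcompE cat_bideg_beta_mul.
apply: (tens_words_ext (f := cat_bideg i.+1 j \o (beta_mul s \o ptens w))
  (g := tcat V \o (ptens (in1 V c) \o cat_bideg i j)) _ z) => x y.
rewrite !lcompE cat_bideg_beta_mul //.
rewrite [alpha _ _ _]/(idfun : {linear tensalg V -> tensalg V}) on_slots_id.
rewrite cat_bidegE add1n eqSS add0n.
by case: ifP => _; [rewrite tcatE | rewrite !linear0].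
Qed.

Lemma cat_bideg_right i j c z :
  cat_bideg i j (beta_mul s ((word [::] \ox in1 V c) \ox z)) =
  if j is j'.+1 then
    on_slots 0 i.+1 (alpha s 1 i) (in1 V c ** cat_bideg i j' z)
  else 0.
Proof.
pose w := (word [::] : tensalg V) \ox in1 V c.
case: j => [|j].
  apply: (tens_words_ext (f := cat_bideg i 0 \o (beta_mul s \o ptens w))
    (g := \0) _ z) => x y.
  by rewrite !lcompE cat_bideg_beta_mul ?andbF //; apply: alpha_1i_graded.
apply: (tens_words_ext (f := cat_bideg i j.+1 \o (beta_mul s \o ptens w))
  (g := on_slots 0 i.+1 (alpha s 1 i) \o (tcat V \o (ptens (in1 V c) \o cat_bideg i j)))) => x y.
rewrite !lcompE cat_bideg_beta_mul; last exact: alpha_1i_graded.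
rewrite cat_bidegE add0n add1n eqSS; case: ifP => [/andP[/eqP <- _]|_].
  by rewrite tcatE.
by rewrite !linear0.
Qed.

Lemma cat_bideg_both i j d z :
  cat_bideg i j (beta_mul s (tmap (in1 V) (in1 V) d \ox z)) =
  match i, j with
  | i'.+1, j'.+1 =>
    on_slots 1 i (alpha s 1 i') (in2 V d ** cat_bideg i' j' z)
  | _, _ => 0
  end.
Proof.
elim/ptens_ind: d => [|a c c' d IH].
  rewrite [tmap _ _ 0]linear0 linear0l [beta_mul s 0]linear0 linear0.
  by case: i j => [|i] [|j] //; rewrite [in2 V 0]linear0 linear0l [tcat V 0]linear0 linear0.
rewrite [tmap _ _ (_ + _)]linearP linearPl [beta_mul s (_ + _)]linearP.
rewrite [cat_bideg _ _ (_ + _)]linearP {}IH.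
have -> : cat_bideg i j (beta_mul s (tmap (in1 V) (in1 V) (c \ox c') \ox z)) =
  match i, j with
  | i'.+1, j'.+1 =>
    on_slots 1 i (alpha s 1 i') (word [:: c; c'] ** cat_bideg i' j' z)
  | _, _ => 0
  end.
  rewrite tmapE; pose w := in1 V c \ox in1 V c'.
  case: i j => [|i] [|j].
  1-3: by apply: (tens_words_ext (f := cat_bideg _ _ \o (beta_mul s \o ptens w))
      (g := \0) _ z) => x y; rewrite !lcompE cat_bideg_beta_mul ?andbF //;
      apply: alpha_1i_graded.
  apply: (tens_words_ext (f := cat_bideg i.+1 j.+1 \o (beta_mul s \o ptens w))
    (g := on_slots 1 i.+1 (alpha s 1 i) \o
          (tcat V \o (ptens (word [:: c; c']) \o cat_bideg i j)))) => x y.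
  rewrite !lcompE cat_bideg_beta_mul; last exact: alpha_1i_graded.
  rewrite cat_bidegE !add1n !eqSS; case: ifP => [/andP[/eqP <- _]|_].
    by rewrite tcatE.
  by rewrite !linear0.
case: i j => [|i] [|j]; rewrite ?scaler0 ?addr0 //.
rewrite [in2 V (_ + _)]linearP [in2 V (c \ox c')]tliftE linearPl [tcat V (_ + _)]linearP.
by rewrite [on_slots _ _ _ (_ + _)]linearP.
Qed.

End Bidegree.

(** * The quasi-shuffle product as an adjoint *)

Section QuasiShuffleAdjoint.
Variables (K : fieldType) (A C : lmodType K) (p : {bilinear A -> C -> K^o}).
Local Notation P := (tensalg_pair p).
Local Notation P2 := (tens_pair (tensalg_pair p) (tensalg_pair p)).

Variables (Delta : {linear C -> tens C C}) (mu : {linear tens A A -> A}).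
Variables (sigma : {linear tens C C -> tens C C}) (tau : {linear tens A A -> tens A A}).
Hypothesis htau : is_adjoint (tens_pair p p) (tens_pair p p) sigma tau.
Hypothesis hmu : is_adjoint p (tens_pair p p) Delta mu.

Lemma pair_nil n x : homog n.+1 x -> P x (word [::]) = 0.
Proof. by move=> hx; apply: pair_homog0 hx (homog_word [::]) _. Qed.

Lemma pair_in1_cat n w c y y' :
  (forall x, homog n x -> P x y = P x y') -> homog n.+1 w ->
  P w (in1 C c ** y) = P w (in1 C c ** y').
Proof.
move=> h; elim=> [|b s z hs _ IH]; first by rewrite !linear0l.
rewrite !linearPl {}IH; congr (_ *: _ + _).
case: s hs => // a s [<-] in h *; rewrite -[word (a :: s)](tcatE [:: a] s).
have ha := homog_word [:: a]; have hc := homog_word [:: c].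
by rewrite !(pair_cat _ _ _ ha hc) h //; apply: homog_word.
Qed.

Lemma id_tens_word (g : {linear tensalg A -> tensalg A}) a s :
  id_tens g (word (a :: s)) = in1 A a ** g (word s).
Proof. by rewrite /id_tens !lcompE tsplitE tmapE /= take0 drop0. Qed.

Lemma mu_tens_word (g : {linear tensalg A -> tensalg A}) a b s :
  mu_tens mu g (word [:: a, b & s]) = in1 A (mu (a \ox b)) ** g (word s).
Proof. by rewrite /mu_tens !lcompE tsplitE tmapE !lcompE /= take0 drop0 wliftE. Qed.

(** The hypothesis asks for adjointness against one [y] in one degree only, as
    this is what the induction in [qshuffle_deg_adj] provides. *)
Lemma pair_id_tens (g : {linear tensalg A -> tensalg A}) n w c y y' :
  (forall x, homog n x -> P (g x) y = P x y') -> homog n.+1 w ->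
  P (id_tens g w) (in1 C c ** y) = P w (in1 C c ** y').
Proof.
move=> hg; elim=> [|b s z hs _ IH]; first by rewrite [id_tens g 0]linear0 !linear0l.
rewrite [id_tens g (_ + _)]linearP !linearPl {}IH; congr (_ *: _ + _).
case: s hs => // a s [<-] in hg *.
rewrite id_tens_word -[word (a :: s)](tcatE [:: a] s).
have ha := homog_word [:: a]; have hc := homog_word [:: c].
by rewrite !(pair_cat _ _ _ ha hc) hg //; apply: homog_word.
Qed.

Lemma pair_mu_tens (g : {linear tensalg A -> tensalg A}) n w c y y' :
  (forall x, homog n x -> P (g x) y = P x y') -> homog n.+2 w ->
  P (mu_tens mu g w) (in1 C c ** y) = P w (in2 C (Delta c) ** y').
Proof.
move=> hg; elim=> [|d s z hs _ IH]; first by rewrite [mu_tens mu g 0]linear0 !linear0l.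
rewrite [mu_tens mu g (_ + _)]linearP !linearPl {}IH; congr (_ *: _ + _).
case: s hs => // a [|b s] // [<-] in hg *.
rewrite mu_tens_word -[word [:: a, b & s]](tcatE [:: a; b] s).
have h1 (V : lmodType K) (v : V) : homog 1 (in1 V v) by exact: homog_word [:: v].
rewrite (pair_cat _ _ _ (h1 _ _) (h1 _ c)).
rewrite (pair_cat _ _ _ (homog_word [:: a; b]) (homog_in2 _)).
by rewrite hg ?pair_in1 ?hmu ?pair_in2r ?wliftE //; apply: homog_word.
Qed.

Lemma pair_in1_cat_nil a y : P (in1 A a ** y) (word [::]) = 0.
Proof.
elim/word_ind: y => [|c t y IH].
  by rewrite linear0r [tcat A 0]linear0 linear0l.
rewrite linearPr [tcat A (_ + _)]linearP linearPl IH addr0.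
by rewrite tcatE tensalg_pairE /word_pair scaler0.
Qed.

Lemma pair_id_tens_nil (g : {linear tensalg A -> tensalg A}) n w :
  homog n.+1 w -> P (id_tens g w) (word [::]) = 0.
Proof.
elim=> [|b s z hs _ IH]; first by rewrite [id_tens g 0]linear0 !linear0l.
rewrite [id_tens g (_ + _)]linearP linearPl {}IH addr0.
by case: s hs => // a s _; rewrite id_tens_word pair_in1_cat_nil scaler0.
Qed.

Lemma pair_mu_tens_nil (g : {linear tensalg A -> tensalg A}) n w :
  homog n.+2 w -> P (mu_tens mu g w) (word [::]) = 0.
Proof.
elim=> [|d s z hs _ IH]; first by rewrite [mu_tens mu g 0]linear0 !linear0l.
rewrite [mu_tens mu g (_ + _)]linearP linearPl {}IH addr0.
by case: s hs => // a [|b s] // _; rewrite mu_tens_word pair_in1_cat_nil scaler0.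
Qed.

Lemma adj_alpha i : is_adjoint P P (alpha sigma 1 i) (alpha tau i 1).
Proof. by rewrite alpha_1i alpha_i1; apply: adj_braid_word. Qed.

Lemma adj_on_slots_alpha k q i : is_adjoint P P
  (on_slots k q (alpha sigma 1 i)) (on_slots k q (alpha tau i 1)).
Proof.
apply: adj_on_slots; [exact: alpha_i1_graded | exact: alpha_1i_graded |].
exact: adj_alpha.
Qed.

Lemma qshuffle_degSS i j x : qshuffle_deg mu tau i.+1 j.+1 x =
  id_tens (qshuffle_deg mu tau i j.+1) x +
  (id_tens (qshuffle_deg mu tau i.+1 j) (on_slots 0 i.+2 (alpha tau i.+1 1) x) +
   mu_tens mu (qshuffle_deg mu tau i j) (on_slots 1 i.+1 (alpha tau i 1) x)).
Proof. by []. Qed.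

Lemma qshuffle_deg_i0 i x : qshuffle_deg mu tau i 0 x = x.
Proof. by case: i. Qed.

Variable Phi : {linear tensalg C -> tens (tensalg C) (tensalg C)}.
Hypothesis hPhi : is_Phi Delta sigma Phi.

(** Multiplicativity of [Phi], read in bidegree [(i, j)]: the transpose of the
    recursion [qshuffle_degSS]. *)
Lemma cat_bideg_Phi_cons i j c t :
  cat_bideg C i j (Phi (word (c :: t))) =
  (if j is j'.+1 then
    on_slots 0 i.+1 (alpha sigma 1 i) (in1 C c ** cat_bideg C i j' (Phi (word t)))
   else 0) +
  (if i is i'.+1 then in1 C c ** cat_bideg C i' j (Phi (word t)) else 0) +
  match i, j with
  | i'.+1, j'.+1 => on_slots 1 i (alpha sigma 1 i')
      (in2 C (Delta c) ** cat_bideg C i' j' (Phi (word t)))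
  | _, _ => 0
  end.
Proof.
have [_ hM hc] := hPhi.
rewrite -[word (c :: t)](tcatE [:: c] t) hM -[word [:: c]]/(in1 C c) hc.
rewrite !beta_mulDl ![cat_bideg C i j (_ + _)]linearD.
by congr (_ + _ + _);
  [apply: cat_bideg_right | apply: cat_bideg_left | apply: cat_bideg_both].
Qed.

(** On the empty word both sides vanish unless [i = j = 0], since every term of
    the product has a first letter; on longer words the three terms of the two
    recursions are adjoint to each other. *)
Lemma qshuffle_deg_adj t i j x : homog (i + j) x ->
  P (qshuffle_deg mu tau i j x) (word t) = P x (cat_bideg C i j (Phi (word t))).
Proof.
elim: t i j x => [|c t IH] i j x hx.
  have [-> _ _] := hPhi; rewrite cat_bidegE.
  case: i hx => [|i] hx.
    by case: j hx => [|j] hx //=; rewrite linear0r (pair_nil hx).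
  rewrite /= linear0r; case: j hx => [|j] hx.
    by apply: (pair_nil (n := i + 0)).
  rewrite qshuffle_degSS !linearDl (pair_id_tens_nil _ hx).
  rewrite (pair_id_tens_nil _ (n := i + j.+1)) ?(pair_mu_tens_nil _ (n := i + j)) ?addr0 //.
    by rewrite -addnS; apply: on_slots_graded hx; apply: alpha_i1_graded.
  by apply: on_slots_graded hx; apply: alpha_i1_graded.
rewrite cat_bideg_Phi_cons -[word (c :: t)](tcatE [:: c] t) -[word [:: c]]/(in1 C c).
case: i hx => [|i]; case: j => [|j] hx.
- rewrite !add0r linear0r tcatE.
  exact: pair_homog0 hx (homog_word (c :: t)) _.
- rewrite !addr0 [alpha _ _ _]/(idfun : {linear tensalg C -> tensalg C}) on_slots_id.
  by apply: pair_in1_cat hx => z hz; apply: (IH 0 j z).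
- rewrite addr0 add0r; apply: (pair_in1_cat (n := i + 0)) hx => z hz.
  by rewrite -(IH i 0 z hz) qshuffle_deg_i0.
rewrite qshuffle_degSS !linearDl !linearDr.
rewrite (pair_id_tens _ (IH i j.+1)) //.
rewrite (pair_id_tens (n := i.+1 + j) _ (IH i.+1 j)); last first.
  by rewrite -addnS; apply: on_slots_graded hx; apply: alpha_i1_graded.
rewrite (pair_mu_tens (n := i + j) _ (IH i j)); last first.
  by rewrite -addnS; apply: on_slots_graded hx; apply: alpha_i1_graded.
by rewrite !adj_on_slots_alpha addrCA addrA.
Qed.

Lemma pair_cat_bideg u v z :
  P (word (u ++ v)) (cat_bideg C (size u) (size v) z) = P2 (word u \ox word v) z.
Proof.
apply: (tens_words_ext (W := K^o)
  (f := tensalg_pair p (word (u ++ v)) \o cat_bideg C (size u) (size v))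
  (g := P2 (word u \ox word v)) _ z) => x y.
apply: (etrans _ (esym (tens_pairE P P _ _ _ _))).
rewrite lcompE cat_bidegE !tensalg_pairE.
case: ifP => [/andP[/eqP h1 /eqP h2]|].
  by apply: (etrans (tensalg_pairE p _ _)); apply: word_pair_cat.
rewrite linear0 /word_pair ![size x == _]eq_sym ![size y == _]eq_sym.
by case: eqP => _; case: eqP => _ //; rewrite (mul0r, mulr0).
Qed.

Lemma qshuffle_adj : is_adjoint P P2 Phi (qshuffle mu tau).
Proof.
move=> z y; elim/word_ind: y => [|a t y IH]; first by rewrite [Phi 0]linear0 !linear0r.
rewrite [Phi _]linearP !linearPr {}IH; congr (_ *: _ + _).
apply: (tens_words_ext (W := K^o) (f := applyr P (word t) \o qshuffle mu tau)
  (g := applyr P2 (Phi (word t))) _ z) => u v.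
apply: (etrans _ (pair_cat_bideg u v _)); rewrite lcompE bigradedE.
by apply: qshuffle_deg_adj; rewrite -size_cat; apply: homog_word.
Qed.

End QuasiShuffleAdjoint.

(** * Non-degeneracy of the pairing of the tensor algebras *)

Section Nondegenerate.
Variables (K : fieldType) (A C : lmodType K) (p : {bilinear A -> C -> K^o}).
Hypothesis hp : forall a, (forall c, p a c = 0) -> a = 0.

(** To adjoin a vector [b], add to the list its defect [b'] together with a
    vector [c'] that pairs to [0] with all vectors already expanded and to [1]
    with [b]; the pairs found before can stay as they are. *)
Lemma dual_expansion (s : seq A) : exists l : seq (A * C),
  forall a, a \in s -> a = \sum_(q <- l) (p a q.2 : K) *: q.1.
Proof.
elim: s => [|b s [l hl]]; first by exists [::].
pose b' := b - \sum_(q <- l) (p b q.2 : K) *: q.1.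
have [b0|/eqP b0] := pselect (b' = 0).
  exists l => a; rewrite inE => /orP[/eqP ->|]; last exact: hl.
  exact: subr0_eq.
have [c hc] : exists c, p b' c = 1.
  have [c hc] : exists c, p b' c != 0.
    apply: contrapT => h; move/eqP: b0; apply; apply: hp => c.
    by apply: contrapT => /eqP hc; apply: h; exists c.
  by exists ((p b' c : K)^-1 *: c); rewrite linearZr; apply: mulVf.
(* The correction makes [p a c'] the pairing of [c] with the defect of [a]. *)
pose c' := c - \sum_(q <- l) (p q.1 c : K) *: q.2.
have pc' a : p a c' = p (a - \sum_(q <- l) (p a q.2 : K) *: q.1) c.
  rewrite linearBr linearBl linear_sumr linear_sumlz; congr (_ - _).
  by apply: eq_bigr => q _; rewrite linearZr linearZl; apply: mulrC.
exists ((b', c') :: l) => a; rewrite inE big_cons /= pc' => /orP[/eqP ->|ha].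
  by rewrite -/b' hc scale1r subrK.
by rewrite -hl // subrr linear0l scale0r add0r.
Qed.

Fixpoint words (T : Type) (l : seq T) n : seq (seq T) :=
  if n is n'.+1 then [seq x :: w | x <- l, w <- words l n'] else [:: [::]].

Lemma word_expansion l (s : seq A) :
  (forall a, a \in s -> a = \sum_(q <- l) (p a q.2 : K) *: q.1) ->
  word s = \sum_(w <- words l (size s))
    (word_pair p s (map snd w) : K) *: word (map fst w).
Proof.
elim: s => [|a s IH] hl.
  by rewrite big_seq1 /word_pair /= big_nil scale1r.
rewrite -[word (a :: s)](tcatE [:: a] s) -[word [:: a]]/(in1 A a).
rewrite {1}(hl a) ?mem_head // IH; last by move=> b hb; apply: hl; rewrite inE hb orbT.
rewrite [in1 A _]linear_sum linear_sumlz [tcat A _]linear_sum.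
rewrite [words l (size (_ :: _))]/([seq x :: w | x <- l, w <- words l (size s)]) big_allpairs_dep.
apply: eq_bigr => q _.
rewrite [in1 A _]linearZ_LR linearZl_LR [tcat A _]linearZ_LR.
rewrite linear_sumr [tcat A _]linear_sum scaler_sumr; apply: eq_bigr => w _.
rewrite linearZr_LR [tcat A _]linearZ_LR tcatE scalerA; congr (_ *: _).
rewrite -pair_in1 tensalg_pairE; apply: esym.
exact: (@word_pair_cat _ _ _ p [:: a] s [:: q.2] (map snd w)).
Qed.

Lemma size_words (T : eqType) (l : seq T) n w : w \in words l n -> size w = n.
Proof.
elim: n w => [|n IH] w; first by rewrite mem_seq1 => /eqP ->.
by case/allpairsP => -[x v] /= [_ /IH <- ->].
Qed.

(** The truncated expansion of a tensor over words on [l]; it depends on [u] only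
    through its pairings. *)
Definition expand (l : seq (A * C)) N (u : tensalg A) : tensalg A :=
  \sum_(n < N) \sum_(w <- words l n)
    (tensalg_pair p u (word (map snd w)) : K) *: word (map fst w).

Lemma expandD l N a u v :
  expand l N (a *: u + v) = a *: expand l N u + expand l N v.
Proof.
rewrite scaler_sumr -big_split; apply: eq_bigr => n _ /=.
rewrite scaler_sumr -big_split; apply: eq_bigr => w _ /=.
by rewrite linearPl scalerDl -scalerA.
Qed.

Lemma expand_word l N (s : seq A) : (size s < N)%N ->
  (forall a, a \in s -> a = \sum_(q <- l) (p a q.2 : K) *: q.1) ->
  expand l N (word s) = word s.
Proof.
move=> sN hl; rewrite [RHS](word_expansion hl) /expand (bigD1 (Ordinal sN)) //=.
rewrite [X in _ + X]big1 ?addr0 => [|n ns].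
  by apply: eq_bigr => w _; rewrite tensalg_pairE.
rewrite big_seq big1 // => w /size_words hw; rewrite tensalg_pairE /word_pair.
rewrite size_map hw eq_sym ifN ?scale0r //.
Qed.

(** The finitely many letters of [u] can be expanded simultaneously, and then
    [u] is recovered from its pairings. *)
Lemma tensalg_pair_nondegl u : (forall x, tensalg_pair p u x = 0) -> u = 0.
Proof.
have [N [l hu]] : exists N l, expand l N u = u.
  rewrite (presE u); move: (repr u) => r.
  have [l hl] := dual_expansion (flatten (map snd r)).
  have hN q : q \in r -> (size q.2 < (\max_(q <- r) size q.2).+1)%N.
    by move=> hq; rewrite ltnS; exact: (@leq_bigmax_seq _ r xpredT (fun q => size q.2)).
  exists (\max_(q <- r) size q.2).+1, l; move: (\max_(q <- r) _).+1 hN hl => N.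
  elim: r => [|[a s] r IH] hN hl.
    rewrite lext_nil /expand big1 // => n _; rewrite big1 // => w _.
    by rewrite linear0l scale0r.
  rewrite lext_cons expandD /= expand_word ?IH //.
  - by move=> q hq; apply: hN; rewrite inE hq orbT.
  - by move=> b hb; apply: hl; rewrite /= mem_cat hb orbT.
  - by apply: (hN (a, s)); rewrite mem_head.
  - by move=> b hb; apply: hl; rewrite /= mem_cat hb.
move=> h; rewrite -hu /expand big1 // => n _; rewrite big1 // => w _.
by rewrite h scale0r.
Qed.

End Nondegenerate.

Theorem theorem6p6 (K : fieldType) (hK : [pchar K] =i pred0) (C A : lmodType K)
    (Delta : {linear C -> tens C C}) (eps : {linear C -> K^o})
    (sigma : {linear tens C C -> tens C C})
    (hC : braided_coalgebra Delta eps sigma)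
    (p : {bilinear A -> C -> K^o}) (hp : nondegenerate_pairing p)
    (tau : {linear tens A A -> tens A A}) (mu : {linear tens A A -> A})
    (htau : is_adjoint (tens_pair p p) (tens_pair p p) sigma tau)
    (hmu : is_adjoint p (tens_pair p p) Delta mu)
    (hA : braided_algebra mu tau)
    (Phi : {linear tensalg C -> tens (tensalg C) (tensalg C)})
    (hPhi : is_Phi Delta sigma Phi)
    (Psi : {linear tens (tensalg A) (tensalg A) -> tensalg A}) :
  is_adjoint (tensalg_pair p) (tens_pair (tensalg_pair p) (tensalg_pair p))
    Phi Psi <->
  Psi =1 qshuffle mu tau.
Proof.
have hq := qshuffle_adj htau hmu hPhi.
split=> [hPsi z|e z x]; last by rewrite e; apply: hq.
apply: subr0_eq; apply: (tensalg_pair_nondegl hp.1) => x.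
by rewrite linearBl hPsi hq subrr.
Qed.
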